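(* For each prime number $p \ne 3$ there exists a finite-dimensional vector space $V$ with a finite scalar field of characteristic $p$ such that the inequality \begin{align*} H(A) \le\ & 9H(Z) + 8H(Y) + 5H(X) + 6H(W) - 4H(D) - 12H(C) - 11H(B) - H(A)\\ & + 19H(Z|A,B,C) + 17H(Y|A,B,D) + 13H(X|A,C,D) + 11H(W|B,C,D)\\ & + H(A|W,X,Y,Z) + H(A|B,W,X) + 7H(B|D,X,Z) + 4H(B|C,X,Y)\\ & + 7H(C|D,Y,Z) + 5H(C|A,W,Y) + 4H(D|A,W,Z)\\ & + 29\bigl(H(A) + H(B) + H(C) + H(D) - H(A,B,C,D)\bigr) \end{align*} is not a linear rank inequality over $V$; that is, there are subspaces $A,B,C,D,W,X,Y,Z$ of $V$ for which the inequality fails.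
   Context: For subspaces of a finite-dimensional vector space $V$, $H(S)$ denotes the dimension (rank) of the subspace $S$; $H(S_1,\dots,S_m)$ denotes the dimension of the span of $S_1\cup\dots\cup S_m$; and $H(S|T_1,\dots,T_m) = H(S,T_1,\dots,T_m) - H(T_1,\dots,T_m)$. A linear rank inequality over $V$ is a linear inequality among such quantities that is satisfied by every assignment of subspaces of $V$ to the variables. *)

(* Defs.v *)
From HB Require Import structures.
From mathcomp Require Import all_boot all_order all_algebra.

Set Implicit Arguments.
Unset Strict Implicit.
Unset Printing Implicit Defensive.

Import GRing.Theory Num.Theory.
Local Open Scope ring_scope.

(* Ranks are [int]-valued, so that the subtractions below (in conditional ranks
   and in rank inequalities) are not truncated. *)
Definition rank (F : fieldType) (V : vectType F) (s : seq {vspace V}) : int :=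
  (\dim (\sum_(U <- s) U)%VS)%:Z.

Definition cond_rank (F : fieldType) (V : vectType F) (S : {vspace V})
    (s : seq {vspace V}) : int :=
  rank (S :: s) - rank s.

Notation "H[ S , .. , T ]" := (rank (cons S .. (cons T nil) ..))
  (at level 0, S at level 99, T at level 99,
   format "H[ S ,  .. ,  T ]") : ring_scope.

Notation "H[ S | T , .. , U ]" := (cond_rank S (cons T .. (cons U nil) ..))
  (at level 0, S at level 99, T at level 99, U at level 99,
   format "H[ S  |  T ,  .. ,  U ]") : ring_scope.

(* Main.v *)
Require Import Defs.
From HB Require Import structures.
From mathcomp Require Import all_boot all_order all_algebra.
From mathcomp Require Import ring.

(** The witness is the representation of the matroid T8 over F_3, read in
    characteristic p: the basis lines A, B, C, D of F_p^4 and the lines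
    W, X, Y, Z spanned by the sums of three of the four basis vectors.  Every
    conditional rank on the right then vanishes over any field, except
    H(A | W, X, Y, Z): here w + x + y + z = 3 (a + b + c + d), so that
    a = (w + x + y + z) / 3 - w exactly when 3 is invertible.  The remaining
    terms on the right cancel, and the inequality would read 1 <= 0. *)

Set Implicit Arguments.
Unset Strict Implicit.
Unset Printing Implicit Defensive.

Import GRing.Theory Num.Theory.
Local Open Scope ring_scope.

Section Ranks.

Variables (F : fieldType) (V : vectType F).
Implicit Types (S : {vspace V}) (s : seq {vspace V}) (us : seq V).

Lemma rank_vline (v : V) : v != 0 -> H[<[v]>%VS] = 1.
Proof. by move=> v0; rewrite /rank big_seq1 dim_vline v0. Qed.

Lemma cond_rank_eq0 S s : (S <= \sum_(U <- s) U)%VS -> cond_rank S s = 0.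
Proof. by move=> sSs; rewrite /cond_rank /rank big_cons (addv_idPr sSs) subrr. Qed.

(** [zip] stops at the shorter list; once either runs out the sum is empty, and 0 lies in every
    subspace. *)
Lemma lincomb_memv (ks : seq F) us :
  \sum_(ku <- zip ks us) ku.1 *: ku.2 \in (\sum_(U <- map (@vline F V) us) U)%VS.
Proof.
elim: ks us => [|k ks IHks] [|u us] /=; rewrite ?big_nil ?mem0v //.
by rewrite !big_cons memv_add ?memvZ ?memv_line.
Qed.

(** Reduces each vanishing conditional rank to a vector identity with explicit coefficients [ks]. *)
Lemma cond_rank_lincomb (v : V) (ks : seq F) us :
    v = \sum_(ku <- zip ks us) ku.1 *: ku.2 ->
  cond_rank <[v]> (map (@vline F V) us) = 0.
Proof.
by move=> ->; apply: cond_rank_eq0; rewrite -memvE lincomb_memv.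
Qed.

End Ranks.

(** The entries of a row vector are its coefficients on the unit rows, so the four lines span the
    whole space. *)
Lemma rank_delta_row4 (F : fieldType) :
  rank (map (@vline F 'rV[F]_4)
            [:: delta_mx 0 0; delta_mx 0 1; delta_mx 0 2; delta_mx 0 3]) = 4.
Proof.
rewrite /rank; set s := [:: _; _; _; _].
suff -> : (\sum_(U <- map (@vline F _) s) U)%VS = fullv.
  by rewrite dimvf /dim /= mul1n.
apply/vspaceP => v; rewrite memvf.
have -> : v = \sum_(ku <- zip [:: v 0 0; v 0 1; v 0 2; v 0 3] s) ku.1 *: ku.2.
  rewrite [LHS]row_sum_delta !big_ord_recl big_ord0 !big_cons big_nil /=.
  by do ![congr (_ + _)]; congr (v _ _ *: delta_mx _ _); apply: val_inj.
exact: lincomb_memv.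
Qed.

Local Ltac lincomb_field :=
  rewrite !big_cons big_nil /=; apply/rowP => i; rewrite !mxE; field.

Theorem theorem4p2 (p : nat) (p_prime : prime p) (p_neq3 : p <> 3%N) :
  exists (F : finFieldType) (V : vectType F),
    p \in [pchar F] /\
    exists A B C D W X Y Z : {vspace V},
      ~ (H[A] <= 9 * H[Z] + 8 * H[Y] + 5 * H[X] + 6 * H[W]
                 - 4 * H[D] - 12 * H[C] - 11 * H[B] - H[A]
               + 19 * H[Z | A, B, C] + 17 * H[Y | A, B, D]
               + 13 * H[X | A, C, D] + 11 * H[W | B, C, D]
               + H[A | W, X, Y, Z] + H[A | B, W, X]
               + 7 * H[B | D, X, Z] + 4 * H[B | C, X, Y]
               + 7 * H[C | D, Y, Z] + 5 * H[C | A, W, Y]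
               + 4 * H[D | A, W, Z]
               + 29 * (H[A] + H[B] + H[C] + H[D] - H[A, B, C, D])).
Proof.
have charFp := pchar_Fp p_prime.
(* A prime other than 3 does not divide 3; this justifies the coefficients [3^-1] below. *)
have nz3 : 3 != 0 :> 'F_p.
  rewrite -(dvdn_pcharf charFp) dvdn_prime2 //; exact/eqP.
exists 'F_p, 'rV['F_p]_4; split=> //.
have nz (v : 'rV['F_p]_4) i : v 0 i = 1 -> v != 0.
  by apply: contra_eq_neq => ->; rewrite mxE eq_sym oner_eq0.
have /= := rank_delta_row4 'F_p.
set a := delta_mx 0 0; set b := delta_mx 0 1.
set c := delta_mx 0 2; set d := delta_mx 0 3 => rank_abcd.
pose w := b + c + d; pose x := a + c + d; pose y := a + b + d; pose z := a + b + c.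
exists <[a]>%VS, <[b]>%VS, <[c]>%VS, <[d]>%VS, <[w]>%VS, <[x]>%VS, <[y]>%VS, <[z]>%VS.
have cond0 (v : 'rV['F_p]_4) ks us := @cond_rank_lincomb _ _ v ks us.
have [ha hb hc hd] : [/\ H[<[a]>%VS] = 1, H[<[b]>%VS] = 1, H[<[c]>%VS] = 1 & H[<[d]>%VS] = 1].
  by split; apply: rank_vline; [apply: (nz _ 0)|apply: (nz _ 1)|apply: (nz _ 2)|apply: (nz _ 3)]; rewrite !mxE.
have [hw hx hy hz] : [/\ H[<[w]>%VS] = 1, H[<[x]>%VS] = 1, H[<[y]>%VS] = 1 & H[<[z]>%VS] = 1].
  (* The chosen coordinate receives exactly one basis vector, so it is 1 in every characteristic. *)
  by split; apply: rank_vline; [apply: (nz _ 1)|apply: (nz _ 0)|apply: (nz _ 0)|apply: (nz _ 0)];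
    rewrite !mxE /= ?addr0 ?add0r.
rewrite rank_abcd ha hb hc hd hw hx hy hz.
rewrite (cond0 z [:: 1; 1; 1] [:: a; b; c]); last by lincomb_field.
rewrite (cond0 y [:: 1; 1; 1] [:: a; b; d]); last by lincomb_field.
rewrite (cond0 x [:: 1; 1; 1] [:: a; c; d]); last by lincomb_field.
rewrite (cond0 w [:: 1; 1; 1] [:: b; c; d]); last by lincomb_field.
rewrite (cond0 a [:: 3^-1 - 1; 3^-1; 3^-1; 3^-1] [:: w; x; y; z]); last by lincomb_field.
(* Two threefold sums differ by a difference of basis vectors, here [x - w = a - b]; likewise in the
   next five steps. *)
rewrite (cond0 a [:: 1; -1; 1] [:: b; w; x]); last by lincomb_field.
rewrite (cond0 b [:: 1; -1; 1] [:: d; x; z]); last by lincomb_field.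
rewrite (cond0 b [:: 1; -1; 1] [:: c; x; y]); last by lincomb_field.
rewrite (cond0 c [:: 1; -1; 1] [:: d; y; z]); last by lincomb_field.
rewrite (cond0 c [:: 1; 1; -1] [:: a; w; y]); last by lincomb_field.
rewrite (cond0 d [:: 1; 1; -1] [:: a; w; z]); last by lincomb_field.
(* The rank-one terms give 28 - 28 and the last bracket 4 - 4, so [~ (1 <= 0)] remains, decided by
   evaluation. *)
by [].
Qed.
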